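(* Let $r\ge 1$, let $\boldsymbol{\mu}=(\mu_1,\dots,\mu_r)$ be a system of (possibly complex) measures on $\mathbb{R}$ with all moments finite, let $j\in\{1,\dots,r\}$, and let $\boldsymbol{n}\in\mathbb{N}^r$ with $n_j\ge 1$ be normal with respect to $\boldsymbol{\mu}$. Let $\boldsymbol{A}_{\boldsymbol{n}}=(A^{(1)}_{\boldsymbol{n}},\dots,A^{(r)}_{\boldsymbol{n}})$ be the type I multiple orthogonal polynomial of $\boldsymbol{\mu}$ at $\boldsymbol{n}$. Then $$\{z_0\in\mathbb{C}: A^{(j)}_{\boldsymbol{n}}(z_0)=0\}=\{z_0\in\mathbb{C}: \boldsymbol{n}-\boldsymbol{e}_j\text{ is not normal for }\widehat{\boldsymbol{\mu}}_{z_0}\},$$ where $\widehat{\boldsymbol{\mu}}_{z_0}$ is the system obtained from $\boldsymbol{\mu}$ by replacing $\mu_j$ with $(x-z_0)\mu_j$ and leaving all other measures unchanged (for $j=1$: $((x-z_0)\mu_1,\mu_2,\dots,\mu_r)$).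
   Context: $\mathbb{N}=\{0,1,2,\dots\}$; for $\boldsymbol{n}\in\mathbb{N}^r$, $|\boldsymbol{n}|=n_1+\dots+n_r$; $\boldsymbol{e}_j$ is the $j$-th standard unit vector. For a system $\boldsymbol{\mu}=(\mu_1,\dots,\mu_r)$ of (possibly complex) measures on $\mathbb{R}$ with finite moments, an index $\boldsymbol{n}\in\mathbb{N}^r$ is called normal if there is a unique monic polynomial $P_{\boldsymbol{n}}$ of exact degree $|\boldsymbol{n}|$ with $\int P_{\boldsymbol{n}}(x)x^k\,d\mu_i(x)=0$ for $k=0,\dots,n_i-1$, $i=1,\dots,r$. Equivalently, the $|\boldsymbol{n}|\times|\boldsymbol{n}|$ matrix obtained by stacking, for $i=1,\dots,r$, the blocks $\big(\int x^{p+q}d\mu_i(x)\big)_{0\le p\le n_i-1,\,0\le q\le|\boldsymbol{n}|-1}$ has non-zero determinant (the empty determinant being $1$). For $\boldsymbol{n}\neq\boldsymbol{0}$ this is also equivalent to existence and uniqueness of the type I multiple orthogonal polynomial at $\boldsymbol{n}$: a non-zero vector of polynomials $\boldsymbol{A}_{\boldsymbol{n}}=(A^{(1)}_{\boldsymbol{n}},\dots,A^{(r)}_{\boldsymbol{n}})$ with $\deg A^{(i)}_{\boldsymbol{n}}\le n_i-1$ (so $A^{(i)}_{\boldsymbol{n}}=0$ if $n_i=0$) and $\sum_{i=1}^r\int A^{(i)}_{\boldsymbol{n}}(x)x^k\,d\mu_i(x)$ equal to $0$ for $k=0,\dots,|\boldsymbol{n}|-2$ and equal to $1$ for $k=|\boldsymbol{n}|-1$.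 For a measure $\mu$ and $z_0\in\mathbb{C}$, $(x-z_0)\mu$ denotes the measure $\widehat\mu$ with $\int f\,d\widehat\mu=\int f(x)(x-z_0)\,d\mu(x)$. *)

(* Defs.v *)
From HB Require Import structures.
From mathcomp Require Import all_boot all_order all_algebra.
From mathcomp Require Import complex.
From mathcomp Require Import all_classical all_reals all_analysis.

Set Implicit Arguments.
Unset Strict Implicit.
Unset Printing Implicit Defensive.

Import Order.TTheory GRing.Theory Num.Theory.

Local Open Scope classical_set_scope.
Local Open Scope ring_scope.
Local Open Scope complex_scope.

Section SignedMeasure.
Context {R : realType}.
Notation T := (measurableTypeR R).
Implicit Types (nu : {charge set T -> \bar R}) (f : R -> R).

(* A Hahn decomposition is chosen to name the Jordan decomposition; the latter
   does not depend on this choice. *)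
Definition hahn_pos nu : set T := sval (cid (Hahn_decomposition nu)).

Definition hahn_neg nu : set T :=
  sval (cid (svalP (cid (Hahn_decomposition nu)))).

Lemma hahn_posneg nu : hahn_decomposition nu (hahn_pos nu) (hahn_neg nu).
Proof. exact: svalP (cid (svalP (cid (Hahn_decomposition nu)))). Qed.

Definition jpos nu : {finite_measure set T -> \bar R} :=
  jordan_pos (hahn_posneg nu).

Definition jneg nu : {finite_measure set T -> \bar R} :=
  jordan_neg (hahn_posneg nu).

Definition charge_integrable nu f : Prop :=
  (jpos nu).-integrable setT (EFin \o f) /\
  (jneg nu).-integrable setT (EFin \o f).

Definition charge_integral nu f : R :=
  Rintegral (jpos nu) setT f - Rintegral (jneg nu) setT f.

(* The signed measure f nu, i.e. B |-> \int_B f d nu. *)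
Definition charge_density nu f (nuf : charge_integrable nu f) :
    {charge set T -> \bar R} :=
  cadd (induced_charge nuf.1) (copp (induced_charge nuf.2)).

End SignedMeasure.

(* A complex measure on the Borel sets of R, given by its real and imaginary
   parts; a charge is a countably additive set function with finite values. *)
Record cmeasure (R : realType) := CMeasure {
  cm_re : {charge set (measurableTypeR R) -> \bar R};
  cm_im : {charge set (measurableTypeR R) -> \bar R} }.

Section ComplexMeasure.
Context {R : realType}.
Implicit Types (mu : cmeasure R) (z : R[i]).

Definition finite_moments mu : Prop := forall k : nat,
  charge_integrable (cm_re mu) (fun x => x ^+ k) /\
  charge_integrable (cm_im mu) (fun x => x ^+ k).

(* \int (g + i h) d(a + i b)
     = (\int g da - \int h db) + i (\int g db + \int h da) *)
Definition cintegral mu (f : R -> R[i]) : R[i] :=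
  let re_f x := complex.Re (f x) in
  let im_f x := complex.Im (f x) in
  (charge_integral (cm_re mu) re_f - charge_integral (cm_im mu) im_f) +i*
  (charge_integral (cm_im mu) re_f + charge_integral (cm_re mu) im_f).

Lemma subr_integrable (nu : {charge set (measurableTypeR R) -> \bar R}) (u : R) :
  (forall k : nat, charge_integrable nu (fun x => x ^+ k)) ->
  charge_integrable nu (fun x => x - u).
Proof.
move=> h; have [p1 n1] := h 1%N; have [p0 n0] := h 0%N.
have E : EFin \o (fun x : R => x - u) =
    ((EFin \o (fun x : R => (x ^+ 1)%R)) \-
     (fun x => u%:E * (EFin \o (fun x : R => (x ^+ 0)%R)) x))%E.
  by apply/funext => x; congr (_%:E); rewrite expr1 expr0 mulr1.
split; rewrite E; apply: integrableB => //; exact: integrableZl.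
Qed.

Lemma finite_moments_re mu (hmu : finite_moments mu) (u : R) :
  charge_integrable (cm_re mu) (fun x => x - u).
Proof. by apply: subr_integrable => k; case: (hmu k). Qed.

Lemma finite_moments_im mu (hmu : finite_moments mu) (u : R) :
  charge_integrable (cm_im mu) (fun x => x - u).
Proof. by apply: subr_integrable => k; case: (hmu k). Qed.

(* The complex measure (x - z) mu: for mu = a + i b and z = u + i v,
     (x - z) mu = ((x - u) a + v b) + i ((x - u) b - v a). *)
Definition christoffel mu (hmu : finite_moments mu) z : cmeasure R :=
  let u := complex.Re z in
  let v := complex.Im z in
  CMeasure
    (cadd (charge_density (finite_moments_re hmu u)) (cscale v (cm_im mu)))
    (cadd (charge_density (finite_moments_im hmu u)) (cscale (- v) (cm_re mu))).

End ComplexMeasure.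

Section MultipleOrthogonality.
Context {R : realType} {r : nat}.
Implicit Types (mu : 'I_r -> cmeasure R) (n : 'I_r -> nat).

Definition index_size n : nat := (\sum_(i < r) n i)%N.

(* n - e_j, meaningful when 1 <= n j *)
Definition index_pred n (j : 'I_r) : 'I_r -> nat := fun i => (n i - (i == j))%N.

Definition normal_index mu n : Prop :=
  exists! P : {poly R[i]},
    [/\ P \is monic, size P = (index_size n).+1 &
      forall (i : 'I_r) (k : nat), (k < n i)%N ->
        cintegral (mu i) (fun x => P.[x%:C] * x%:C ^+ k) = 0].

(* Meant for n <> 0: for n = 0 the truncated |n| - 1 is 0, but no A qualifies. *)
Definition typeI mu n (A : 'I_r -> {poly R[i]}) : Prop :=
  let L k := \sum_(i < r) cintegral (mu i) (fun x => (A i).[x%:C] * x%:C ^+ k) in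
  [/\ exists i, A i != 0,
      forall i, (size (A i) <= n i)%N,
      forall k : nat, (k.+1 < index_size n)%N -> L k = 0 &
      L (index_size n).-1 = 1].

(* The measure of index j is replaced by (x - z) mu_j. *)
Definition christoffel_system mu (hmu : forall i, finite_moments (mu i))
    (j : 'I_r) (z : R[i]) : 'I_r -> cmeasure R :=
  fun i => if i == j then christoffel (hmu i) z else mu i.

End MultipleOrthogonality.

(* Main.v *)
(* Normality of n amounts to invertibility of the moment matrix, that is, to the
   absence of a nonzero vector B with deg B_i < n_i whose type I linear form
   vanishes on x^k for all k < |n|. Let mu^ be the system with (x - z) mu_j in
   place of mu_j. If A_j = (x - z) q, replacing A_j by q in A gives such a vector
   for (mu^, n - e_j). Conversely, multiplying the j-th entry of such a vector by
   x - z gives a vector whose type I form for mu vanishes on x^k for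
   k < |n| - 1; by normality of n it is a nonzero multiple of A, so A_j(z) = 0. *)
From HB Require Import structures.
Require Import Defs.
From mathcomp Require Import all_boot all_order all_algebra.
From mathcomp Require Import complex.
From mathcomp Require Import all_classical all_reals all_analysis.
From mathcomp Require Import measurable_realfun ring.

Set Implicit Arguments.
Unset Strict Implicit.
Unset Printing Implicit Defensive.

Import Order.TTheory GRing.Theory Num.Theory.

Local Open Scope classical_set_scope.
Local Open Scope ring_scope.
Local Open Scope complex_scope.

(** * Integrals against densities and sums of measures *)

Section Density.
Context d (T : measurableType d) (R : realType).
Local Open Scope ereal_scope.

(** Since [nu] is absolutely continuous with respect to [m], the change of variables holds for the
    Radon-Nikodym derivative. That derivative and [g] have the same integral over every measurable
    set, hence agree almost everywhere. *)
Lemma ge0_integral_density (nu m : {finite_measure set T -> \bar R})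
    (g : T -> \bar R) (f : T -> \bar R) :
  m.-integrable setT g -> (forall x, 0 <= g x) ->
  (forall A, measurable A -> nu A = \int[m]_(x in A) g x) ->
  measurable_fun setT f -> (forall x, 0 <= f x) ->
  \int[nu]_x f x = \int[m]_x (f x * g x).
Proof.
move=> ig g0 nuE mf f0.
have numu : nu `<< m.
  apply/null_content_dominatesP => A mA mA0; rewrite nuE//.
  by apply: null_set_integral => //; apply: measurable_funTS; exact: measurable_int ig.
have RNi := Radon_Nikodym_SigmaFinite.f_integrable numu.
rewrite -(Radon_Nikodym_SigmaFinite.change_of_variables numu)//.
apply: ge0_ae_eq_integral => //.
- by apply: emeasurable_funM => //; exact: measurable_int RNi.
- by apply: emeasurable_funM => //; exact: measurable_int ig.
- by move=> x _; rewrite mule_ge0// Radon_Nikodym_SigmaFinite.f_ge0.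
- by move=> x _; rewrite mule_ge0.
- apply: ae_eqe_mul2l; apply: integral_ae_eq => //.
  + exact: measurable_int ig.
  + by move=> E _ mE; rewrite -nuE// -Radon_Nikodym_SigmaFinite.f_integral.
Qed.

(** This compares the differences [m1 - m3] and [m4 - m2] with no subtraction, so that each side is
    the integral against one genuine measure. *)
Lemma integral_add4 (m1 m2 m3 m4 : {measure set T -> \bar R})
    (f : T -> \bar R) :
  (forall A, measurable A -> m1 A + m2 A = m3 A + m4 A) ->
  m1.-integrable setT f -> m2.-integrable setT f ->
  m3.-integrable setT f -> m4.-integrable setT f ->
  \int[m1]_x f x + \int[m2]_x f x = \int[m3]_x f x + \int[m4]_x f x.
Proof.
move=> m1234 i1 i2 i3 i4; rewrite -!integral_measure_add//.
by apply: eq_measure_integral => A mA _; have /= := m1234 A mA; rewrite -!measure_addE.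
Qed.

(** The integral of [|f|] against a summand is at most its integral against the whole sum. *)
Lemma integrable_summand (m m1 m2 m3 : {measure set T -> \bar R})
    (f : T -> \bar R) :
  (forall A, measurable A -> m A = m1 A + (m2 A + m3 A)) ->
  m.-integrable setT f -> m1.-integrable setT f.
Proof.
move=> mE /integrableP[mf foo]; apply/integrableP; split=> //.
apply: le_lt_trans foo.
pose m23 : {measure set T -> \bar R} := measure_add m2 m3.
have -> : \int[m]_x `|f x| = \int[measure_add m1 m23]_x `|f x|.
  apply: eq_measure_integral => A mA _; have /= := mE A mA.
  by rewrite -measure_addE -(measure_addE m1 m23).
have mabs : measurable_fun setT (fun x => `|f x|) by exact: measurableT_comp.
by rewrite ge0_integral_measure_add// leeDl// integral_ge0.
Qed.

(** As [g] is nonnegative, multiplication by [g] commutes with taking positive and negative parts of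
    [f], which reduces the claim to nonnegative integrands. *)
Lemma integral_density (nu m : {finite_measure set T -> \bar R})
    (f g : T -> R) :
  m.-integrable setT (EFin \o g) -> (forall x, 0 <= g x)%R ->
  (forall A, measurable A -> nu A = \int[m]_(x in A) (g x)%:E) ->
  measurable_fun setT f ->
  m.-integrable setT (EFin \o (fun x => f x * g x)%R) ->
  nu.-integrable setT (EFin \o f) /\
  Rintegral nu setT f = Rintegral m setT (fun x => f x * g x)%R.
Proof.
move=> ig g0 nuE mf ifg.
have mEf : measurable_fun setT (EFin \o f) by exact/measurable_EFinP.
have ge0E (h : T -> \bar R) := @ge0_integral_density nu m (EFin \o g) h ig g0 nuE.
have posM x : (EFin \o f)^\+ x * (g x)%:E = (EFin \o (fun x => f x * g x)%R)^\+ x.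
  by rewrite !funeposE /= -!EFin_max -EFinM maxr_pMl// mul0r.
have negM x : (EFin \o f)^\- x * (g x)%:E = (EFin \o (fun x => f x * g x)%R)^\- x.
  by rewrite !funenegE /= -!EFin_max -EFinM maxr_pMl// mul0r mulNr.
split.
- apply/integrableP; split=> //.
  rewrite ge0E//; last exact: measurableT_comp.
  have /integrableP[_] := ifg.
  by under eq_integral do rewrite /= normrM (ger0_norm (g0 _)) EFinM.
- rewrite /Rintegral; congr fine; rewrite integralE [RHS]integralE.
  rewrite !ge0E//; [|exact: measurable_funeneg|exact: measurable_funepos].
  by congr (_ - _); apply: eq_integral => x _; [exact: posM|exact: negM].
Qed.

Lemma integrable_measure_add (m1 m2 : {measure set T -> \bar R})
    (f : T -> \bar R) :
  m1.-integrable setT f -> m2.-integrable setT f ->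
  (measure_add m1 m2).-integrable setT f.
Proof.
move=> /integrableP[mf f1] /integrableP[_ f2]; apply/integrableP; split=> //.
have mabs : measurable_fun setT (fun x => `|f x|) by exact: measurableT_comp.
by rewrite ge0_integral_measure_add// lte_add_pinfty.
Qed.

Lemma Rintegral_measure_add (m1 m2 : {measure set T -> \bar R}) (f : T -> R) :
  m1.-integrable setT (EFin \o f) -> m2.-integrable setT (EFin \o f) ->
  Rintegral (measure_add m1 m2) setT f =
  (Rintegral m1 setT f + Rintegral m2 setT f)%R.
Proof.
move=> f1 f2; rewrite /Rintegral integral_measure_add//.
by rewrite fineD//; exact: integrable_fin_num.
Qed.

(** The charge induced by a nonnegative integrable [g] has nonnegative finite values, so it can be
    repackaged as a finite measure. *)
Lemma density_exists (m : {finite_measure set T -> \bar R}) (g : T -> R) :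
  m.-integrable setT (EFin \o g) -> (forall x, 0 <= g x)%R ->
  exists nu : {finite_measure set T -> \bar R},
    forall A, nu A = \int[m]_(x in A) (g x)%:E.
Proof.
move=> ig g0.
have ind0 E : 0 <= induced_charge ig E.
  by apply: integral_ge0 => x _; rewrite lee_fin.
pose nu0 := measure_of_charge _ ind0.
have nu0fin : fin_num_fun nu0.
  by move=> A mA; exact: (fin_num_measure (induced_charge ig)).
pose nuFin := Measure_isFinite.Build _ _ _ nu0 nu0fin.
pose nu : {finite_measure set T -> \bar R} := HB.pack nu0 nuFin.
by exists nu.
Qed.

End Density.

(** * Jordan parts and integrals against a charge *)

Section ChargeIntegral.
Context {R : realType}.
Notation T := (measurableTypeR R).
Implicit Types (nu : {charge set T -> \bar R}) (f : R -> R).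

Lemma hahn_pos_measurable nu : measurable (hahn_pos nu).
Proof. by case: (hahn_posneg nu) => -[]. Qed.

Lemma hahn_neg_measurable nu : measurable (hahn_neg nu).
Proof. by case: (hahn_posneg nu) => _ []. Qed.

Lemma jposE nu (A : set T) : measurable A -> jpos nu A = nu (A `&` hahn_pos nu).
Proof. by move=> mA; rewrite /jpos/= /jordan_pos/= /measure_of_charge/= /crestr0 mem_set. Qed.

Lemma jnegE nu (A : set T) : measurable A ->
  jneg nu A = (- nu (A `&` hahn_neg nu))%E.
Proof.
move=> mA; have := jordan_negE (hahn_posneg nu) A.
by rewrite cjordan_negE /crestr0 mem_set.
Qed.

Lemma jposB nu (A : set T) : measurable A -> (nu A = jpos nu A - jneg nu A)%E.
Proof.
by move=> mA; rewrite (jordan_decomp (hahn_posneg nu))// /cadd /= cscaleN1.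
Qed.

(* If P, N is a Hahn decomposition of nu, then p = jpos nu + p|_(~P) + q|_P and
   q = jneg nu + q|_(~N) + p|_N, so integrability passes from p and q to the
   Jordan parts. *)
Lemma charge_integral_diff nu (p q : {measure set T -> \bar R}) f :
  (forall A, measurable A -> p A \is a fin_num) ->
  (forall A, measurable A -> q A \is a fin_num) ->
  (forall A, measurable A -> (nu A = p A - q A)%E) ->
  p.-integrable setT (EFin \o f) -> q.-integrable setT (EFin \o f) ->
  charge_integrable nu f /\
  charge_integral nu f = Rintegral p setT f - Rintegral q setT f.
Proof.
move=> pfin qfin nuE pf qf.
have mP := hahn_pos_measurable nu; have mN := hahn_neg_measurable nu.
have mCP := measurableC mP; have mCN := measurableC mN.
have split (m : {measure set T -> \bar R}) (A B : set T) :
    measurable A -> measurable B -> (m A = m (A `&` B) + m (A `&` ~` B))%E.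
  move=> mA mB; rewrite -measureU//; last 3 first.
  - exact: measurableI.
  - by apply: measurableI => //; exact: measurableC.
  - by rewrite setIACA setICr setI0.
  by rewrite -setIUr setUv setIT.
have jpf : (jpos nu).-integrable setT (EFin \o f).
  apply: (@integrable_summand _ _ _ p _ (mrestr p mCP) (mrestr q mP)) => //.
  move=> A mA; rewrite [X in _ = (X + _)%E](jposE nu mA) nuE; last exact: measurableI.
  have mAP : measurable (A `&` hahn_pos nu) by exact: measurableI.
  rewrite [LHS](split p _ _ mA mP) /mrestr.
  rewrite [X in (_ = _ + X)%E]addeC addeA subeK//; exact: qfin.
have jnf : (jneg nu).-integrable setT (EFin \o f).
  apply: (@integrable_summand _ _ _ q _ (mrestr q mCN) (mrestr p mN)) => //.
  move=> A mA; rewrite [X in _ = (X + _)%E](jnegE nu mA) nuE; last exact: measurableI.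
  have mAN : measurable (A `&` hahn_neg nu) by exact: measurableI.
  rewrite [LHS](split q _ _ mA mN) /mrestr.
  rewrite fin_num_oppeB; last exact: qfin.
  rewrite [X in (_ = _ + X)%E]addeC addeA [(- _ + _)%E]addeC subeK//; exact: pfin.
split=> //; rewrite /charge_integral /Rintegral.
(* The two presentations [jpos nu - jneg nu] and [p - q] of [nu] are compared after moving the
   negative terms across; all values are finite, so this is legitimate. *)
have H : (\int[jpos nu]_x (EFin \o f) x + \int[q]_x (EFin \o f) x =
          \int[p]_x (EFin \o f) x + \int[jneg nu]_x (EFin \o f) x)%E.
  apply: integral_add4 => // A mA.
  change (jpos nu A + q A = p A + jneg nu A)%E.
  have := nuE _ mA; rewrite jposB//.
  have := fin_num_measure (jpos nu) A mA; have := fin_num_measure (jneg nu) A mA.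
  have := pfin A mA; have := qfin A mA.
  move: (p A) (q A) (jpos nu A) (jneg nu A).
  move=> [x| |] // [y| |] // [z| |] // [t| |] // _ _ _ _ [e].
  by congr (_%:E); rewrite -[z](subrK t) e addrAC subrK.
have := integrable_fin_num measurableT jpf.
have := integrable_fin_num measurableT jnf.
have := integrable_fin_num measurableT pf.
have := integrable_fin_num measurableT qf.
move: H => /= H f1 f2 f3 f4; apply/eqP; rewrite subr_eq addrAC eq_sym subr_eq.
by rewrite -!fineD// H.
Qed.

End ChargeIntegral.

(** * Type I relations and the moment matrix over a field *)

Section MultipleOrthogonality.
Variables (F : fieldType) (r : nat).
Implicit Types (L : 'I_r -> {scalar {poly F}}) (n : 'I_r -> nat).
Implicit Types (B : 'I_r -> {poly F}).

Lemma rVpolyE d (v : 'rV[F]_d) : rVpoly v = \sum_(k < d) v 0 k *: 'X^k.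
Proof.
rewrite /rVpoly poly_def; apply: eq_bigr => k _; congr (_ *: _).
by rewrite (_ : insub _ = Some k)//; exact: valK.
Qed.

(** The homogeneous version of the type I conditions: vanishing is also required at the last degree
    [|n| - 1], and [B = 0] is allowed. *)
Definition typeI_relation L n B : Prop :=
  (forall i, (size (B i) <= n i)%N) /\
  (forall k, (k < \sum_(i < r) n i)%N -> \sum_(i < r) L i (B i * 'X^k) = 0).

Definition monic_orthogonal L n (P : {poly F}) : Prop :=
  [/\ P \is monic, size P = (\sum_(i < r) n i).+1 &
    forall i k, (k < n i)%N -> L i (P * 'X^k) = 0].

Section MomentMatrix.
Variables (L : 'I_r -> {scalar {poly F}}) (n : 'I_r -> nat).
Notation I := {i : 'I_r & 'I_(n i)}.
Notation N := #|{: I}|.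

Notation fam a := (tag (enum_val a : I)).
Notation pw a := (nat_of_ord (tagged (enum_val a : I))).

Lemma card_index : N = (\sum_(i < r) n i)%N.
Proof.
by rewrite card_tagged sumnE big_map big_enum; apply: eq_bigr => i _; rewrite card_ord.
Qed.

(** Rows are the pairs [(i, p)] with [p < n i], in the order of the enumeration of this sigma type.
    Up to a permutation of rows this is the stacked moment matrix. *)
Definition moment_mx : 'M[F]_N := \matrix_(a < N, q < N)
  L (fam a) 'X^(pw a + q).

(** The right-hand side of the linear system for the lower coefficients of a monic orthogonal
    polynomial, coming from its leading term ['X^N]. *)
Definition moment_rhs : 'rV[F]_N := \row_(a < N) - L (fam a) 'X^(N + pw a).

Definition glue_row (b : forall i, 'rV[F]_(n i)) : 'rV[F]_N :=
  \row_(a < N) b (fam a) 0 (tagged (enum_val a : I)).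

(** Thus the left kernel of the moment matrix consists of the type I relations; the sum over pairs
    is only regrouped as a double sum. *)
Lemma glue_row_moment_mx b q :
  (glue_row b *m moment_mx) 0 q = \sum_(i < r) L i (rVpoly (b i) * 'X^q).
Proof.
rewrite mxE.
under eq_bigr do rewrite !mxE.
rewrite -(big_enum_val (fun s : I => b (tag s) 0 (tagged s) * L (tag s) 'X^(tagged s + q))) /=.
transitivity (\sum_(i < r) \sum_(p < n i) b i 0 p * L i 'X^(p + q)).
  by rewrite sig_big_dep /=; apply: eq_bigl => -[].
apply: eq_bigr => i _; rewrite rVpolyE mulr_suml linear_sum; apply: eq_bigr => p _.
by rewrite -scalerAl linearZ exprD.
Qed.

(** The same matrix read the other way: its transpose encodes the type II orthogonality conditions
    on one polynomial. *)
Lemma rVpoly_moment_mx (c : 'rV[F]_N) a :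
  (c *m moment_mx^T) 0 a = L (fam a) (rVpoly c * 'X^(pw a)).
Proof.
rewrite mxE rVpolyE mulr_suml linear_sum; apply: eq_bigr => q _.
by rewrite !mxE -scalerAl linearZ -exprD addnC.
Qed.

Lemma moment_mx_unitP :
  reflect (forall B, typeI_relation L n B -> forall i, B i = 0)
          (moment_mx \in unitmx).
Proof.
apply: (iffP idP) => [uM B [sB LB] i|ker].
- pose b i : 'rV[F]_(n i) := poly_rV (B i).
  have bE i' : rVpoly (b i') = B i' by exact: poly_rV_K.
  have b0 : glue_row b = 0.
    rewrite -(mulmxK uM (glue_row b)) (_ : glue_row b *m _ = 0) ?mul0mx//.
    apply/rowP => q; rewrite glue_row_moment_mx mxE.
    under eq_bigr do rewrite bE.
    by rewrite LB// -card_index.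
  rewrite -bE (_ : b i = 0) ?linear0//; apply/rowP => p; rewrite mxE.
  have /rowP/(_ (enum_rank (Tagged (fun i => 'I_(n i)) p : I))) := b0.
  by rewrite !mxE enum_rankK.
- rewrite -row_free_unit; apply: inj_row_free => v vM0.
  (* The row [v] is cut into blocks, inverting [glue_row]. *)
  pose b i : 'rV[F]_(n i) := \row_p v 0 (enum_rank (Tagged (fun i => 'I_(n i)) p : I)).
  have vE : v = glue_row b.
    by apply/rowP => a; rewrite !mxE -[in LHS](enum_valK a); case: (enum_val a).
  have B0 := ker (fun i => rVpoly (b i)); rewrite vE.
  have {}B0 : forall i, rVpoly (b i) = 0.
    apply: B0; split=> [i|k]; first exact: size_poly.
    rewrite -card_index => kN.
    by rewrite -(glue_row_moment_mx b (Ordinal kN)) -vE vM0 mxE.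
  by apply/rowP => a; rewrite mxE -coef_rVpoly_ord B0 coef0 mxE.
Qed.

Lemma monic_orthogonal_rVpoly (c : 'rV[F]_N) :
  monic_orthogonal L n ('X^N + rVpoly c) <->
  c *m moment_mx^T = moment_rhs.
Proof.
have sc : (size (rVpoly c) <= N)%N by exact: size_poly.
have eqa i (p : 'I_(n i)) a : enum_val a = Tagged (fun i => 'I_(n i)) p :> I ->
    (c *m moment_mx^T) 0 a = L i (rVpoly c * 'X^p).
  by move=> aE; rewrite rVpoly_moment_mx aE.
split=> [[_ _ PL]|cM].
- apply/rowP => a; rewrite rVpoly_moment_mx mxE.
  apply/eqP; rewrite -addr_eq0 addrC exprD -linearD -mulrDl.
  by apply/eqP; exact: PL.
- have sP : size ('X^N + rVpoly c) = N.+1 by rewrite size_polyDl size_polyXn.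
  split; first by rewrite monicE lead_coefDl ?lead_coefXn// size_polyXn.
    by rewrite sP card_index.
  move=> i k kn; pose p := Ordinal kn.
  pose a := enum_rank (Tagged (fun i => 'I_(n i)) p : I).
  have aE : enum_val a = Tagged (fun i => 'I_(n i)) p :> I by rewrite enum_rankK.
  have := eqa _ _ _ aE; rewrite cM mxE aE /= => e.
  by rewrite mulrDl linearD -exprD -e subrr.
Qed.

End MomentMatrix.

(** Monic orthogonal polynomials solve an affine system with matrix the transpose of [moment_mx],
    while type I relations form the left kernel of [moment_mx]. Unique solvability and triviality of
    that kernel both amount to invertibility. *)
Lemma monic_orthogonal_uniqP L n :
  (exists! P, monic_orthogonal L n P) <->
  (forall B, typeI_relation L n B -> forall i, B i = 0).
Proof.
set N := #|{: {i : 'I_r & 'I_(n i)}}|.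
have monicE P : monic_orthogonal L n P ->
    exists2 c : 'rV[F]_N, P = 'X^N + rVpoly c & c = poly_rV (P - 'X^N).
  move=> [Pm sP _]; exists (poly_rV (P - 'X^N)) => //.
  have sB : (size (P - 'X^N)%R <= N)%N.
    apply/leq_sizeP => k Nk; rewrite coefB coefXn.
    have sP' : size P = N.+1 by rewrite sP -(card_index n).
    have [kN|kN] := eqVneq k N.
      by have /monicP := Pm; rewrite lead_coefE sP' kN => ->; rewrite subrr.
    by rewrite subr0 nth_default// sP' ltn_neqAle eq_sym kN.
  by rewrite (poly_rV_K sB) addrC subrK.
split=> [[P [PL Puniq]]|/moment_mx_unitP uM].
- apply/moment_mx_unitP; rewrite -unitmx_tr -row_free_unit.
  apply: inj_row_free => v vM0.
  have [c cE _] := monicE _ PL.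
  have := PL; rewrite cE => /monic_orthogonal_rVpoly cM.
  (* Adding a kernel vector [v] to the lower coefficients of [P] gives another solution, so
     uniqueness forces [v = 0]. *)
  have /monic_orthogonal_rVpoly/Puniq : (c + v) *m (moment_mx L n)^T =
      moment_rhs L n.
    by rewrite mulmxDl vM0 addr0.
  rewrite cE linearD addrA -{1}['X^N + _]addr0 => /addrI /esym v0.
  by rewrite -[v]rVpolyK v0 linear0.
- pose b : 'rV[F]_N := moment_rhs L n.
  have uMT : (moment_mx L n)^T \in unitmx by rewrite unitmx_tr.
  exists ('X^N + rVpoly (b *m invmx (moment_mx L n)^T)); split.
    by apply/monic_orthogonal_rVpoly; rewrite mulmxKV.
  move=> P PL; have [c cE _] := monicE _ PL.
  have := PL; rewrite cE => /monic_orthogonal_rVpoly cM.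
  by rewrite -[in LHS](_ : c *m (moment_mx L n)^T = b)// mulmxK.
Qed.

(** The algebraic core of the theorem, with measures replaced by arbitrary linear functionals on
    polynomials over a field. *)
Lemma typeI_root_relation L L' n (j : 'I_r) (z : F) B :
  (0 < n j)%N ->
  (forall P, L' j P = L j (('X - z%:P) * P)) ->
  (forall i P, i != j -> L' i P = L i P) ->
  (forall B', typeI_relation L n B' -> forall i, B' i = 0) ->
  (exists i, B i != 0) ->
  (forall i, (size (B i) <= n i)%N) ->
  (forall k, (k.+1 < \sum_(i < r) n i)%N -> \sum_(i < r) L i (B i * 'X^k) = 0) ->
  \sum_(i < r) L i (B i * 'X^((\sum_(i < r) n i).-1)) = 1 ->
  (B j).[z] = 0 <->
  ~ (forall B', typeI_relation L' (fun i => n i - (i == j))%N B' ->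
       forall i, B' i = 0).
Proof.
move=> nj L'j L'i ker [i0 Bi0] sB LB0 LB1.
set N := (\sum_(i < r) n i)%N in LB0 LB1.
have N'E : (\sum_(i < r) (n i - (i == j)))%N = N.-1.
  rewrite /N (bigD1 j)//= [in RHS](bigD1 j)//= eqxx.
  rewrite (eq_bigr (fun i => n i)); last by move=> i /negbTE ->; rewrite subn0.
  by case: (n j) nj => // m _; rewrite subn1.
have N_gt0 : (0 < N)%N by rewrite /N (bigD1 j)//= addn_gt0 nj.
(* The factor ['X - z%:P] passes from the functional of index [j] to the entry of index [j]; this
   transports relations between the two systems in both directions. *)
have sumE (C D : 'I_r -> {poly F}) k : C j = ('X - z%:P) * D j ->
    (forall i, i != j -> C i = D i) ->
    \sum_(i < r) L' i (D i * 'X^k) = \sum_(i < r) L i (C i * 'X^k).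
  move=> Cj Ci; apply: eq_bigr => i _; have [->|ij] := eqVneq i j.
    by rewrite L'j Cj mulrA.
  by rewrite L'i// Ci.
split=> [/rootP/factor_theorem[q qE] ker'|nker].
(* Dividing the [j]-th entry by ['X - z%:P] lowers its size by one, as [n - e_j] demands, and
   [k < N.-1] is exactly the range where the form of [B] vanishes. Then [D = 0] would force
   [B = 0]. *)
- pose D i := if i == j then q else B i.
  have Bj : B j = ('X - z%:P) * D j by rewrite qE mulrC /D eqxx.
  have Bi i : i != j -> B i = D i by rewrite /D => /negbTE ->.
  have D0 : forall i, D i = 0.
    apply: ker'; split=> [i|k]; last first.
      by rewrite N'E => kN; rewrite (sumE B D)// LB0//; case: N N_gt0 kN {LB0 LB1 N'E}.
    have [->|ij] := eqVneq i j; last by rewrite subn0 -Bi.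
    have := sB j; rewrite qE /D eqxx; have [->|q0] := eqVneq q 0.
      by rewrite size_poly0.
    by rewrite size_Mmonic ?monicXsubC// size_XsubC addn2 subn1 /=; case: (n j).
  by case/negP: Bi0; have [->|ij] := eqVneq i0 j; rewrite ?Bj ?(Bi i0 ij) D0 ?mulr0.
- have [//|Bjz] := eqVneq (B j).[z] 0; case: nker => D [sD LD].
  pose C i := if i == j then ('X - z%:P) * D j else D i.
  have Cj : C j = ('X - z%:P) * D j by rewrite /C eqxx.
  have Ci i : i != j -> C i = D i by rewrite /C => /negbTE ->.
  (* The form of [B] equals 1 at degree [N.-1], so subtracting [c *: B] from [C] removes the one
     condition that [C] may miss; [ker] then applies to the difference. *)
  pose c := \sum_(i < r) L i (C i * 'X^(N.-1)).
  have CB i : C i = c *: B i.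
    apply/eqP; rewrite -subr_eq0; apply/eqP; move: i.
    apply: (ker (fun i => C i - c *: B i)); split=> [i|k].
      apply: leq_trans (size_polyD _ _) _; rewrite size_polyN geq_max.
      apply/andP; split; last exact: leq_trans (size_scale_leq _ _) (sB i).
      have [->|ij] := eqVneq i j; last by have := sD i; rewrite Ci// (negbTE ij) subn0.
      have := sD j; rewrite Cj eqxx; have [->|D0] := eqVneq (D j) 0.
        by rewrite mulr0 size_poly0.
      rewrite size_monicM ?monicXsubC// size_XsubC add2n /= => h.
      by rewrite (leq_ltn_trans h)// subn1 ltn_predL.
    rewrite -/N => kN.
    under eq_bigr do rewrite mulrBl linearB -scalerAl linearZ.
    rewrite sumrB -mulr_sumr.
    have [kE|kN1] := eqVneq k N.-1; first by rewrite kE LB1 mulr1 subrr.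
    have k1 : (k < N.-1)%N by rewrite ltn_neqAle kN1 -ltnS prednK.
    rewrite LB0 ?mulr0 ?subr0; last by rewrite -ltn_predRL.
    by rewrite -(sumE C D)// LD// N'E.
  move=> i.
  (* At [z] the [j]-th entry of [C] vanishes while that of [B] does not. *)
  have c0 : c = 0.
    have /eqP := congr1 (horner^~ z) (CB j).
    by rewrite Cj !hornerE subrr mul0r eq_sym mulf_eq0 (negbTE Bjz) orbF => /eqP.
  have C0 i' : C i' = 0 by rewrite CB c0 scale0r.
  have [->|ij] := eqVneq i j; last by rewrite -Ci.
  have /eqP := C0 j; rewrite Cj mulf_eq0 polyXsubC_eq0 /= => /eqP//.
Qed.

End MultipleOrthogonality.

(** * Integrals against sums, densities and multiples of charges *)

Section ChargeOperations.
Context {R : realType}.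
Notation T := (measurableTypeR R).
Implicit Types (nu : {charge set T -> \bar R}) (f : R -> R).

Lemma charge_integral_diff_add nu (p1 p2 q1 q2 : {finite_measure set T -> \bar R}) f :
  (forall A, measurable A -> nu A = (p1 A + p2 A) - (q1 A + q2 A))%E ->
  p1.-integrable setT (EFin \o f) -> p2.-integrable setT (EFin \o f) ->
  q1.-integrable setT (EFin \o f) -> q2.-integrable setT (EFin \o f) ->
  charge_integrable nu f /\
  charge_integral nu f = (Rintegral p1 setT f + Rintegral p2 setT f) -
                         (Rintegral q1 setT f + Rintegral q2 setT f).
Proof.
move=> nuE f1 f2 g1 g2.
pose p : {measure set T -> \bar R} := measure_add p1 p2.
pose q : {measure set T -> \bar R} := measure_add q1 q2.
have pE A : (p A = p1 A + p2 A)%E by exact: measure_addE.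
have qE A : (q A = q1 A + q2 A)%E by exact: measure_addE.
have := @charge_integral_diff _ nu p q f.
rewrite !Rintegral_measure_add//; apply.
- by move=> A mA; rewrite pE fin_numD; apply/andP; split; exact: fin_num_measure.
- by move=> A mA; rewrite qE fin_numD; apply/andP; split; exact: fin_num_measure.
- by move=> A mA; rewrite pE qE nuE.
- exact: integrable_measure_add.
- exact: integrable_measure_add.
Qed.

(** The sums of the Jordan parts present [cadd nu1 nu2] as a difference of measures. This is in
    general not its Jordan decomposition, but any such presentation computes the integral. *)
Lemma charge_integral_cadd nu1 nu2 f :
  charge_integrable nu1 f -> charge_integrable nu2 f ->
  charge_integrable (cadd nu1 nu2) f /\
  charge_integral (cadd nu1 nu2) f = charge_integral nu1 f + charge_integral nu2 f.
Proof.
move=> [p1 n1] [p2 n2].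
have [] := @charge_integral_diff_add (cadd nu1 nu2)
  (jpos nu1) (jpos nu2) (jneg nu1) (jneg nu2) f => //.
  move=> A mA; transitivity (nu1 A + nu2 A)%E => //.
  rewrite (jposB nu1)// (jposB nu2)//.
  by rewrite fin_num_oppeD; [rewrite addeACA|exact: fin_num_measure].
move=> i ->; split=> //; rewrite /charge_integral.
by rewrite opprD addrACA.
Qed.

(** Splitting both [h] and [nu] by sign gives four finite measures, to each of which the nonnegative
    density formula applies. Only the values of [nu'] are prescribed, so that the result covers both
    [charge_density] and [cscale]. *)
Lemma charge_integral_density nu nu' h f :
  charge_integrable nu h ->
  (forall A : set T, measurable A ->
    nu' A = (\int[jpos nu]_(x in A) (h x)%:E - \int[jneg nu]_(x in A) (h x)%:E)%E) ->
  measurable_fun setT (f : T -> R) -> charge_integrable nu (fun x => f x * h x) ->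
  charge_integrable nu' f /\
  charge_integral nu' f = charge_integral nu (fun x => f x * h x).
Proof.
move=> [hp hn] nu'E mf [fhp fhn].
have hpp := integrable_funrpos measurableT hp.
have hpn := integrable_funrneg measurableT hp.
have hnp := integrable_funrpos measurableT hn.
have hnn := integrable_funrneg measurableT hn.
have mh : measurable_fun setT (h : T -> R) by apply/measurable_EFinP; exact: measurable_int hp.
have mulp (m : {measure set T -> \bar R}) : m.-integrable setT (EFin \o (fun x => f x * h x)) ->
    m.-integrable setT (EFin \o (fun x => f x * h^\+ x)).
  apply: le_integrable => //.
    by apply/measurable_EFinP; apply: measurable_funM => //; exact: measurable_funrpos.
  move=> x _; rewrite /= lee_fin !normrM ler_wpM2l// ger0_norm ?funrpos_ge0//.
  by rewrite /funrpos ge_max normr_ge0 ler_norm.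
have muln (m : {measure set T -> \bar R}) : m.-integrable setT (EFin \o (fun x => f x * h x)) ->
    m.-integrable setT (EFin \o (fun x => f x * h^\- x)).
  apply: le_integrable => //.
    by apply/measurable_EFinP; apply: measurable_funM => //; exact: measurable_funrneg.
  move=> x _; rewrite /= lee_fin !normrM ler_wpM2l// ger0_norm ?funrneg_ge0//.
  by rewrite /funrneg ge_max normr_ge0 -normrN ler_norm.
have RB (m : {measure set T -> \bar R}) : m.-integrable setT (EFin \o (fun x => f x * h x)) ->
    Rintegral m setT (fun x => f x * h x) =
    Rintegral m setT (fun x => f x * h^\+ x) - Rintegral m setT (fun x => f x * h^\- x).
  move=> i; rewrite -RintegralB//; [|exact: mulp|exact: muln].
  by apply: eq_Rintegral => x _; rewrite -mulrBr -{1}(funrposBneg h).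
have [pp ppE] := density_exists hpp (funrpos_ge0 h).
have [pn pnE] := density_exists hpn (funrneg_ge0 h).
have [np npE] := density_exists hnp (funrpos_ge0 h).
have [nn nnE] := density_exists hnn (funrneg_ge0 h).
have [ipp Ipp] := integral_density (nu := pp) (f := f)
  hpp (funrpos_ge0 h) (fun A _ => ppE A) mf (mulp _ fhp).
have [ipn Ipn] := integral_density (nu := pn) (f := f)
  hpn (funrneg_ge0 h) (fun A _ => pnE A) mf (muln _ fhp).
have [inp Inp] := integral_density (nu := np) (f := f)
  hnp (funrpos_ge0 h) (fun A _ => npE A) mf (mulp _ fhn).
have [inn Inn] := integral_density (nu := nn) (f := f)
  hnn (funrneg_ge0 h) (fun A _ => nnE A) mf (muln _ fhn).
(* Equal signs of [h] and [nu] contribute positively ([pp], [nn]), opposite signs negatively ([pn],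
   [np]). *)
have [] := @charge_integral_diff_add nu' pp nn pn np f => //.
  move=> A mA; rewrite nu'E//.
  have split (m : {measure set T -> \bar R}) : m.-integrable setT (EFin \o h) ->
    (\int[m]_(x in A) (h x)%:E = \int[m]_(x in A) (h^\+ x)%:E - \int[m]_(x in A) (h^\- x)%:E)%E.
    move=> hi; rewrite -integralB_EFin//.
    + by apply: eq_integral => x _; rewrite -EFinB -{1}(funrposBneg h).
    + by apply: (integrableS measurableT) => //; exact: integrable_funrpos.
    + by apply: (integrableS measurableT) => //; exact: integrable_funrneg.
  rewrite !split// -ppE -pnE -npE -nnE.
  rewrite fin_num_oppeB; last exact: fin_num_measure.
  rewrite [(- np A + _)%E]addeC addeACA fin_num_oppeD//; exact: fin_num_measure.
move=> i ->; split=> //; rewrite Ipp Ipn Inp Inn.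
rewrite /charge_integral !RB//.
by rewrite opprB opprD addrACA.
Qed.

Lemma charge_integral_charge_density nu h f (nuh : charge_integrable nu h) :
  measurable_fun setT (f : T -> R) -> charge_integrable nu (fun x => f x * h x) ->
  charge_integrable (charge_density nuh) f /\
  charge_integral (charge_density nuh) f = charge_integral nu (fun x => f x * h x).
Proof.
by move=> mf fh; apply: charge_integral_density.
Qed.

(** Scaling is the case of a constant density, which handles both signs of [c] at once. *)
Lemma charge_integral_cscale nu (c : R) f :
  charge_integrable nu f ->
  charge_integrable (cscale c nu) f /\
  charge_integral (cscale c nu) f = c * charge_integral nu f.
Proof.
move=> [fp fn].
have mf : measurable_fun setT (f : T -> R) by apply/measurable_EFinP; exact: measurable_int fp.
have [] := @charge_integral_density nu (cscale c nu) (fun=> c) f.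
- by split; apply: finite_measure_integrable_cst.
- move=> A mA; rewrite !integral_cst//; transitivity (c%:E * nu A)%E => //.
  rewrite (jposB nu)// muleBr//.
  by rewrite fin_num_adde_defr// fin_num_measure.
- exact: mf.
- by split; [exact: (integrableZr measurableT c fp)|exact: (integrableZr measurableT c fn)].
move=> i ->; split=> //; by rewrite /charge_integral !RintegralZr// -mulrBl mulrC.
Qed.

End ChargeOperations.

(** * Linearity in the integrand *)

Section ChargeLinearity.
Context {R : realType}.
Notation T := (measurableTypeR R).
Implicit Types (nu : {charge set T -> \bar R}) (f g : R -> R).

Lemma charge_integrableD nu f g :
  charge_integrable nu f -> charge_integrable nu g ->
  charge_integrable nu (fun x => f x + g x).
Proof.
by move=> [f1 f2] [g1 g2]; split;
  [exact: (integrableD measurableT f1 g1)|exact: (integrableD measurableT f2 g2)].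
Qed.

Lemma charge_integrableZ nu c f :
  charge_integrable nu f -> charge_integrable nu (fun x => c * f x).
Proof.
by move=> [f1 f2]; split;
  [exact: (integrableZl measurableT c f1)|exact: (integrableZl measurableT c f2)].
Qed.

Lemma charge_integralD nu f g :
  charge_integrable nu f -> charge_integrable nu g ->
  charge_integral nu (fun x => f x + g x) =
  charge_integral nu f + charge_integral nu g.
Proof.
by move=> [? ?] [? ?]; rewrite /charge_integral !RintegralD// opprD addrACA.
Qed.

Lemma charge_integralZ nu c f :
  charge_integrable nu f ->
  charge_integral nu (fun x => c * f x) = c * charge_integral nu f.
Proof. by move=> [? ?]; rewrite /charge_integral !RintegralZl// -mulrBr. Qed.

End ChargeLinearity.

(** * Complex integrals and the transform [(x - z) mu] *)

Section ComplexIntegral.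
Context {R : realType}.
Implicit Types (mu : cmeasure R) (F G : R -> R[i]) (P Q : {poly R[i]}).

Definition cintegrable mu F : Prop :=
  [/\ charge_integrable (cm_re mu) (fun x => complex.Re (F x)),
      charge_integrable (cm_re mu) (fun x => complex.Im (F x)),
      charge_integrable (cm_im mu) (fun x => complex.Re (F x)) &
      charge_integrable (cm_im mu) (fun x => complex.Im (F x))].

Let ReD (a b : R[i]) : complex.Re (a + b) = complex.Re a + complex.Re b.
Proof. by case: a b => [? ?] [? ?]. Qed.
Let ImD (a b : R[i]) : complex.Im (a + b) = complex.Im a + complex.Im b.
Proof. by case: a b => [? ?] [? ?]. Qed.
Let ReM (a b : R[i]) : complex.Re (a * b) =
  complex.Re a * complex.Re b + - complex.Im a * complex.Im b.
Proof. by case: a b => [? ?] [? ?]; rewrite mulNr. Qed.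
Let ImM (a b : R[i]) : complex.Im (a * b) =
  complex.Re a * complex.Im b + complex.Im a * complex.Re b.
Proof. by case: a b => [? ?] [? ?]. Qed.

Lemma cintegrableD mu F G :
  cintegrable mu F -> cintegrable mu G -> cintegrable mu (fun x => F x + G x).
Proof.
move=> [? ? ? ?] [? ? ? ?]; split;
  under eq_fun do rewrite ?ReD ?ImD; exact: charge_integrableD.
Qed.

Lemma cintegrableZ mu c F : cintegrable mu F -> cintegrable mu (fun x => c * F x).
Proof.
move=> [? ? ? ?]; split;
  under eq_fun do rewrite ?ReM ?ImM;
  by apply: charge_integrableD; exact: charge_integrableZ.
Qed.

Lemma cintegralD mu F G : cintegrable mu F -> cintegrable mu G ->
  cintegral mu (fun x => F x + G x) = cintegral mu F + cintegral mu G.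
Proof.
move=> [? ? ? ?] [? ? ? ?]; rewrite /cintegral.
rewrite (_ : (fun x => complex.Re (F x + G x)) =
  fun x => complex.Re (F x) + complex.Re (G x)); last by apply/funext => x; rewrite ReD.
rewrite (_ : (fun x => complex.Im (F x + G x)) =
  fun x => complex.Im (F x) + complex.Im (G x)); last by apply/funext => x; rewrite ImD.
rewrite !charge_integralD//.
by congr (_ +i* _); [rewrite opprD addrACA|rewrite addrACA].
Qed.

Lemma cintegralZ mu c F : cintegrable mu F ->
  cintegral mu (fun x => c * F x) = c * cintegral mu F.
Proof.
move=> [? ? ? ?]; rewrite /cintegral.
have re : (fun x => complex.Re (c * F x)) = fun x =>
   complex.Re c * complex.Re (F x) + - complex.Im c * complex.Im (F x).
  by apply/funext => x; rewrite ReM.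
have im : (fun x => complex.Im (c * F x)) = fun x =>
   complex.Re c * complex.Im (F x) + complex.Im c * complex.Re (F x).
  by apply/funext => x; rewrite ImM.
rewrite re im !charge_integralD ?charge_integralZ//; try exact: charge_integrableZ.
move: (charge_integral (cm_re mu) (fun x => complex.Re (F x)))
      (charge_integral (cm_re mu) (fun x => complex.Im (F x)))
      (charge_integral (cm_im mu) (fun x => complex.Re (F x)))
      (charge_integral (cm_im mu) (fun x => complex.Im (F x))).
by case: c {re im} => a b p q s t; congr (_ +i* _) => /=; ring.
Qed.

Lemma cintegrable_horner mu P : finite_moments mu ->
  cintegrable mu (fun x => P.[x%:C]).
Proof.
move=> hmu; under eq_fun do rewrite horner_coef.
have monom k : cintegrable mu (fun x => x%:C ^+ k).
  have [a b] := hmu k.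
  have re (x : R) : complex.Re (x%:C ^+ k) = x ^+ k by rewrite -rmorphXn.
  (* The zero imaginary part is written as a multiple of [x ^+ k] so that the moment hypothesis also
     gives its integrability. *)
  have im (x : R) : complex.Im (x%:C ^+ k) = 0 * x ^+ k by rewrite -rmorphXn mul0r.
  by split; [rewrite (funext re)|rewrite (funext im); exact: charge_integrableZ
            |rewrite (funext re)|rewrite (funext im); exact: charge_integrableZ].
elim: (size P) => [|n IH].
  rewrite (_ : (fun _ => _) = fun x : R => 0 * x%:C ^+ 0); first exact: cintegrableZ.
  by apply/funext => x; rewrite big_ord0 mul0r.
under eq_fun do rewrite big_ord_recr /=.
by apply: cintegrableD => //; exact: cintegrableZ.
Qed.

(** The real and imaginary parts of [(x - z) mu] share the shape [(x - u) nu + v nu']; the imaginary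
    part uses it with [- v] and the two charges exchanged. *)
Lemma charge_integral_christoffel_part (nu nu' : {charge set (measurableTypeR R) -> \bar R})
    (u v : R) f (nuu : charge_integrable nu (fun x => x - u)) :
  charge_integrable nu f -> charge_integrable nu (fun x => x * f x) ->
  charge_integrable nu' f ->
  let nu'' := cadd (charge_density nuu) (cscale v nu') in
  charge_integrable nu'' f /\
  charge_integral nu'' f = charge_integral nu (fun x => x * f x)
    - u * charge_integral nu f + v * charge_integral nu' f.
Proof.
move=> nf nxf n'f /=.
have mf : measurable_fun setT (f : measurableTypeR R -> R).
  by apply/measurable_EFinP; case: nf => + _; exact: measurable_int.
have E : (fun x => f x * (x - u)) = fun x => x * f x + (- u) * f x.
  by apply/funext => x; ring.
have nfu : charge_integrable nu (fun x => f x * (x - u)).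
  by rewrite E; apply: charge_integrableD => //; exact: charge_integrableZ.
have [i1 e1] := charge_integral_charge_density nuu mf nfu.
have [i2 e2] := charge_integral_cscale v n'f.
have [i3 ->] := charge_integral_cadd i1 i2; split=> //.
rewrite e1 e2 E charge_integralD//; last exact: charge_integrableZ.
by rewrite charge_integralZ// mulNr.
Qed.

Lemma cintegral_christoffel mu (hmu : finite_moments mu) z F :
  cintegrable mu F -> cintegrable mu (fun x => x%:C * F x) ->
  cintegrable (christoffel hmu z) F /\
  cintegral (christoffel hmu z) F = cintegral mu (fun x => (x%:C - z) * F x).
Proof.
move=> iF ixF; have [a1 a2 b1 b2] := iF; have := ixF.
have re x : complex.Re (x%:C * F x) = x * complex.Re (F x).
  by rewrite ReM /= oppr0 mul0r addr0.
have im x : complex.Im (x%:C * F x) = x * complex.Im (F x).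
  by rewrite ImM /= mul0r addr0.
move=> -[xa1 xa2 xb1 xb2].
have xE : (fun x => (x%:C - z) * F x) = fun x => x%:C * F x + (- z) * F x.
  by apply/funext => x; rewrite mulrDl.
rewrite xE cintegralD//; last exact: cintegrableZ.
rewrite cintegralZ//.
have reE := funext re; have imE := funext im.
rewrite reE in xa1 xb1; rewrite imE in xa2 xb2.
have [c1 e1] := charge_integral_christoffel_part (complex.Im z)
  (finite_moments_re hmu (complex.Re z)) a1 xa1 b1.
have [c2 e2] := charge_integral_christoffel_part (complex.Im z)
  (finite_moments_re hmu (complex.Re z)) a2 xa2 b2.
have [c3 e3] := charge_integral_christoffel_part (- complex.Im z)
  (finite_moments_im hmu (complex.Re z)) b1 xb1 a1.
have [c4 e4] := charge_integral_christoffel_part (- complex.Im z)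
  (finite_moments_im hmu (complex.Re z)) b2 xb2 a2.
split; first by split.
rewrite {1}/cintegral /christoffel /= e1 e2 e3 e4 /cintegral reE imE.
(* With the eight real integrals generalized, complex multiplication by [- z] is a polynomial
   identity in each component. *)
move: (charge_integral (cm_re mu) (fun x => complex.Re (F x)))
      (charge_integral (cm_re mu) (fun x => complex.Im (F x)))
      (charge_integral (cm_im mu) (fun x => complex.Re (F x)))
      (charge_integral (cm_im mu) (fun x => complex.Im (F x)))
      (charge_integral (cm_re mu) (fun x => x * complex.Re (F x)))
      (charge_integral (cm_re mu) (fun x => x * complex.Im (F x)))
      (charge_integral (cm_im mu) (fun x => x * complex.Re (F x)))
      (charge_integral (cm_im mu) (fun x => x * complex.Im (F x))).
by case: z {xE c1 e1 c2 e2 c3 e3 c4 e4} => u v p q s t p' q' s' t'; congr (_ +i* _) => /=; ring.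
Qed.

End ComplexIntegral.

(** Bundles linear maps into the structure over which the algebraic part is stated. *)
Lemma scalar_family (K : nzRingType) (V : lmodType K) (I : Type) (f : I -> V -> K) :
  (forall i, scalar (f i)) ->
  exists L : I -> {scalar V}, forall i v, L i v = f i v.
Proof.
move=> fL; have fmix i := GRing.isLinear.Build _ _ _ _ _ (fL i).
pose L i : {scalar V} := HB.pack (f i) (fmix i).
by exists L.
Qed.

(** * Moment functionals and normality *)

Section Functional.
Context {R : realType}.
Implicit Types (mu : cmeasure R) (P Q : {poly R[i]}).

Definition cfunctional mu P : R[i] := cintegral mu (fun x => P.[x%:C]).

Lemma cintegral_hornerMXn mu P k :
  cintegral mu (fun x => P.[x%:C] * x%:C ^+ k) = cfunctional mu (P * 'X^k).
Proof. by congr cintegral; apply/funext => x; rewrite hornerM hornerXn. Qed.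

Lemma cfunctional_scalar mu : finite_moments mu -> scalar (cfunctional mu).
Proof.
move=> hmu a P Q; have iP := cintegrable_horner P hmu.
have iQ := cintegrable_horner Q hmu.
rewrite /cfunctional -cintegralZ// -cintegralD//; last exact: cintegrableZ.
by congr cintegral; apply/funext => x; rewrite hornerD hornerZ.
Qed.

Lemma cfunctional_christoffel mu (hmu : finite_moments mu) z P :
  cfunctional (christoffel hmu z) P = cfunctional mu (('X - z%:P) * P).
Proof.
rewrite /cfunctional; have [|_ ->] := cintegral_christoffel hmu z (cintegrable_horner P hmu).
  rewrite (_ : (fun x => _) = fun x : R => ('X * P).[x%:C]).
    exact: cintegrable_horner.
  by apply/funext => x; rewrite hornerM hornerX.
by congr cintegral; apply/funext => x; rewrite hornerM hornerXsubC.
Qed.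

(** Linearity is inherited from [mu] through multiplication by ['X - z%:P], without passing through
    the moments of the transformed measure. *)
Lemma cfunctional_christoffel_scalar mu (hmu : finite_moments mu) z :
  scalar (cfunctional (christoffel hmu z)).
Proof.
move=> a P Q; rewrite !cfunctional_christoffel mulrDr -scalerAr.
exact: cfunctional_scalar.
Qed.

(** Stated for any linear [L] that agrees with the integrals, so that it serves both the original
    and the transformed system. *)
Lemma normal_indexP (r : nat) (nu : 'I_r -> cmeasure R) (n : 'I_r -> nat)
    (L : 'I_r -> {scalar {poly R[i]}}) :
  (forall i P, L i P = cfunctional (nu i) P) ->
  normal_index nu n <-> (forall B, typeI_relation L n B -> forall i, B i = 0).
Proof.
move=> LE; rewrite -monic_orthogonal_uniqP /normal_index.
rewrite (_ : (fun P => _) = monic_orthogonal L n)//.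
apply/funext => P; apply/propext; split=> -[Pm sP PL]; split=> // i k kn.
  by rewrite LE -cintegral_hornerMXn PL.
by rewrite cintegral_hornerMXn -LE PL.
Qed.

End Functional.

Theorem theorem4p8 (R : realType) (r : nat) (hr : (1 <= r)%N)
    (mu : 'I_r -> cmeasure R) (hmu : forall i, finite_moments (mu i))
    (j : 'I_r) (n : 'I_r -> nat) (hnj : (1 <= n j)%N) (hn : normal_index mu n)
    (A : 'I_r -> {poly R[i]}) (hA : typeI mu n A) :
  [set z0 : R[i] | (A j).[z0] = 0] =
  [set z0 : R[i] | ~ normal_index (christoffel_system hmu j z0) (index_pred n j)].
Proof.
have [L LE] := scalar_family (fun i => cfunctional_scalar (hmu i)).
have ker := (normal_indexP n LE).1 hn.
have [A0 sA LA0 LA1] := hA.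
have LAE k : \sum_(i < r) cintegral (mu i) (fun x => (A i).[x%:C] * x%:C ^+ k) =
    \sum_(i < r) L i (A i * 'X^k).
  by apply: eq_bigr => i _; rewrite LE cintegral_hornerMXn.
rewrite LAE in LA1.
have {}LA0 k : (k.+1 < \sum_(i < r) n i)%N -> \sum_(i < r) L i (A i * 'X^k) = 0.
  by move=> kn; rewrite -LAE LA0.
have root_nonnormal z : (A j).[z] = 0 <->
    ~ normal_index (christoffel_system hmu j z) (index_pred n j).
  have L'lin i : scalar (cfunctional (christoffel_system hmu j z i)).
    rewrite /christoffel_system; case: ifP => _.
      exact: cfunctional_christoffel_scalar.
    exact: cfunctional_scalar.
  have [L' L'E] := scalar_family L'lin.
  rewrite (normal_indexP (index_pred n j) L'E).
  (* What remains is the relation between the two families: multiplication by ['X - z%:P] at [j],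
     equality elsewhere. *)
  apply: (typeI_root_relation (L := L)) => // [P|i P ij].
    by rewrite L'E LE /christoffel_system eqxx cfunctional_christoffel.
  by rewrite L'E LE /christoffel_system (negbTE ij).
by apply/seteqP; split=> z /root_nonnormal.
Qed.
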